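(* Let $p>2$ and $\lambda\in\mathbb{R}$. Let $\mathcal{G}$ be a noncompact metric graph with nonempty compact core $\mathcal{K}$, and assume that $\mathcal{G}$ contains a cycle $\mathscr{C}$ whose edges have pairwise commensurable lengths (i.e. the ratio of the lengths of any two edges of $\mathscr{C}$ is rational). Then there exists $\mu>0$ for which there is at least one bound state of mass $\mu$ (for the NLS equation on $\mathcal{G}$ with nonlinearity localized on $\mathcal{K}$ and Kirchhoff conditions), with Lagrange multiplier $\lambda$ and supported on $\mathcal{K}$.
   Context: Metric graphs. A metric graph $\mathcal{G}$ is a connected multigraph (multiple edges and self-loops allowed) with finitely many edges; each edge $e$ is identified either with a bounded interval $I_e=[0,\ell_e]$, $\ell_e>0$ (bounded edge, coordinate $x_e$ with arbitrary orientation), or with $I_e=[0,+\infty)$ (half-line, attached to the graph at its vertex $x_e=0$; the point at infinity is not a vertex), the edges being joined at their endpoints, the vertices. $\mathcal{G}$ is noncompact if and only if it contains at least one half-line. The compact core $\mathcal{K}$ is the metric subgraph consisting of all bounded edges. A cycle consists of bounded edges; a self-loop, or two edges joining the same two vertices, count as cycles. Function spaces. A function $u:\mathcal{G}\to\mathbb{C}$ is a family $\{u_e\}$ with $u_e:I_e\to\mathbb{C}$. $\|u\|_{L^p(\mathcal{G})}^p=\sum_e\|u_e\|_{L^p(I_e)}^p$. $H^1(\mathcal{G})$ is the space of continuous $u:\mathcal{G}\to\mathbb{C}$ (components agree at common vertices) with $u_e\in H^1(I_e;\mathbb{C})$ for every edge $e$. For $\mu>0$, $H^1_\mu(\mathcal{G})=\{u\in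 H^1(\mathcal{G}):\|u\|_{L^2(\mathcal{G})}^2=\mu\}$. Bound states. Let $\kappa:\mathcal{G}\to\{0,1\}$ be the characteristic function of $\mathcal{K}$ and $p>2$. A bound state of mass $\mu$ with Lagrange multiplier $\lambda\in\mathbb{R}$ is a function $u\in H^1_\mu(\mathcal{G})$ such that $u_e''+\kappa(x)|u_e|^{p-2}u_e=\lambda u_e$ on every edge $e$, and $\sum_{e\succ \mathrm{v}}\frac{du_e}{dx_e}(\mathrm{v})=0$ for every vertex $\mathrm{v}\in\mathcal{K}$ (Kirchhoff condition), where the sum is over all edges incident at $\mathrm{v}$ and $\frac{du_e}{dx_e}(\mathrm{v})$ is $u_e'(0)$ or $-u_e'(\ell_e)$ according to whether $x_e$ equals $0$ or $\ell_e$ at $\mathrm{v}$. A bound state is supported on $\mathcal{K}$ if it vanishes identically on all half-lines of $\mathcal{G}$. *)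

(* Defs.v *)
From HB Require Import structures.
From mathcomp Require Import all_boot all_order all_algebra.
From mathcomp Require Import complex.
From mathcomp Require Import all_classical all_reals all_analysis.

Set Implicit Arguments.
Unset Strict Implicit.
Unset Printing Implicit Defensive.

Import Order.TTheory GRing.Theory Num.Theory.
Import numFieldNormedType.Exports.

Local Open Scope classical_set_scope.
Local Open Scope ring_scope.
Local Open Scope complex_scope.

(** Both kinds of edges come with their coordinate: a bounded edge [e] is
    [[0, elen e]], glued at [x = 0] to [esrc e] and at [x = elen e] to
    [etgt e] (self-loops and multiple edges are allowed); a half-line [h] is
    [[0, +oo[], glued at [x = 0] to [hsrc h]. *)
Record multigraph (R : realType) := Multigraph {
  vertex : finType;
  bounded_edge : finType;
  half_line : finType;
  elen : bounded_edge -> R;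
  esrc : bounded_edge -> vertex;
  etgt : bounded_edge -> vertex;
  hsrc : half_line -> vertex }.

Section MetricGraph.
Context {R : realType}.

(** Half-lines have a single vertex, so they play no role in connectedness. *)
Definition adjacent (G : multigraph R) : rel (vertex G) := fun v w =>
  [exists e : bounded_edge G,
     ((esrc e == v) && (etgt e == w)) || ((esrc e == w) && (etgt e == v))].

Record metric_graph := MetricGraph {
  graph_of :> multigraph R;
  elen_gt0 : forall e : bounded_edge graph_of, 0 < elen e;
  graph_connected :
    forall v w : vertex graph_of, connect (@adjacent graph_of) v w }.

Definition edge (G : metric_graph) : Type :=
  (bounded_edge G + half_line G)%type.

Definition noncompact (G : metric_graph) : Prop :=
  inhabited (half_line G).

Definition nonempty_core (G : metric_graph) : Prop :=
  inhabited (bounded_edge G).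

Definition core_vertex (G : metric_graph) (v : vertex G) : Prop :=
  exists e : bounded_edge G, esrc e = v \/ etgt e = v.

Definition edge_dom (G : metric_graph) (e : edge G) : set R :=
  match e with
  | inl b => [set` `[0, elen b]]
  | inr _ => [set` `[0, +oo[]
  end.

Definition kappa (G : metric_graph) (e : edge G) : R :=
  match e with inl _ => 1 | inr _ => 0 end.

(** A bounded edge with a direction of travel; [(e, true)] is traversed from
    [esrc e] to [etgt e]. *)
Definition dart (G : metric_graph) : Type := (bounded_edge G * bool)%type.

Definition dart_from (G : metric_graph) (d : dart G) : vertex G :=
  if d.2 then esrc d.1 else etgt d.1.

Definition dart_to (G : metric_graph) (d : dart G) : vertex G :=
  if d.2 then etgt d.1 else esrc d.1.

(** Distinctness of the vertices alone would still allow going back and forth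
    along one edge. *)
Definition is_cycle (G : metric_graph) (c : seq (dart G)) : Prop :=
  [/\ c != [::],
      cycle (fun d d' => dart_to d == dart_from d') c,
      uniq (map fst c) &
      uniq (map (@dart_from G) c)].

Definition commensurable (G : metric_graph) (c : seq (dart G)) : Prop :=
  forall e e' : bounded_edge G, e \in map fst c -> e' \in map fst c ->
    rational (elen e / elen e').

Definition L2 (D : set R) (f : R -> R) : Prop :=
  measurable_fun D f /\
  (@lebesgue_measure R).-integrable D (fun x => (f x ^+ 2)%:E).

Definition test_function (D : set R) (phi : R -> R) : Prop :=
  (forall n x, derivable (derive1n n phi) x 1) /\
  exists a b : R, `[a, b] `<=` D° /\ forall x, x \notin `[a, b] -> phi x = 0.

Definition weak_derivative (D : set R) (f g : R -> R) : Prop :=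
  forall phi, test_function D phi ->
    \int[@lebesgue_measure R]_(x in D) (f x * derive1 phi x) =
    - \int[@lebesgue_measure R]_(x in D) (g x * phi x).

Definition H1 (D : set R) (f : R -> R) : Prop :=
  L2 D f /\ exists2 g, L2 D g & weak_derivative D f g.

Definition re (u : R -> R[i]) : R -> R := fun x => complex.Re (u x).
Definition im (u : R -> R[i]) : R -> R := fun x => complex.Im (u x).

(** [u e x] is only meaningful for [x] in [edge_dom e]; its values elsewhere
    are arbitrary. *)
Definition gfun (G : metric_graph) : Type := edge G -> R -> R[i].

Definition gcontinuous (G : metric_graph) (u : gfun G) : Prop :=
  (forall e, {within edge_dom e, continuous (re (u e))} /\
             {within edge_dom e, continuous (im (u e))}) /\
  exists w : vertex G -> R[i],
    (forall b : bounded_edge G,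
       u (inl b) 0 = w (esrc b) /\ u (inl b) (elen b) = w (etgt b)) /\
    (forall h : half_line G, u (inr h) 0 = w (hsrc h)).

Definition gH1 (G : metric_graph) (u : gfun G) : Prop :=
  gcontinuous u /\
  forall e, H1 (edge_dom e) (re (u e)) /\ H1 (edge_dom e) (im (u e)).

Definition mass (G : metric_graph) (u : gfun G) : \bar R :=
  (\sum_(e : edge G) \int[@lebesgue_measure R]_(x in edge_dom e)
     ((Normc.normc (u e x)) ^+ 2)%:E)%E.

Definition gH1_mass (G : metric_graph) (mu : R) (u : gfun G) : Prop :=
  gH1 u /\ mass u = mu%:E.

(** Derivatives of [R -> R[i]] are taken componentwise. *)
Definition twice_derivable (u : R -> R[i]) (x : R) : Prop :=
  [/\ derivable (re u) x 1, derivable (im u) x 1,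
      derivable (derive1 (re u)) x 1 & derivable (derive1 (im u)) x 1].

Definition second_derivative (u : R -> R[i]) (x : R) : R[i] :=
  (derive1n 2 (re u) x) +i* (derive1n 2 (im u) x).

(** One-sided difference quotients with nonzero increment [h]: [h --> 0^'+]
    gives the right derivative, [h --> 0^'-] the left derivative. *)
Definition one_sided_derivative
    (F : set_system R) (f : R -> R) (x d : R) : Prop :=
  h^-1 * (f (x + h) - f x) @[h --> F] --> d.

Definition right_derivative (u : R -> R[i]) (x : R) (d : R[i]) : Prop :=
  one_sided_derivative (0^'+) (re u) x (complex.Re d) /\
  one_sided_derivative (0^'+) (im u) x (complex.Im d).

Definition left_derivative (u : R -> R[i]) (x : R) (d : R[i]) : Prop :=
  one_sided_derivative (0^'-) (re u) x (complex.Re d) /\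
  one_sided_derivative (0^'-) (im u) x (complex.Im d).

Definition nls (G : metric_graph) (p lambda : R) (u : gfun G) : Prop :=
  forall (e : edge G) (x : R), (edge_dom e)° x ->
    twice_derivable (u e) x /\
    second_derivative (u e) x
      + (kappa e * Normc.normc (u e x) `^ (p - 2))%:C * u e x
    = lambda%:C * u e x.

(** [d0] and [d1] are the derivatives at the initial and final endpoints; a
    self-loop at [v] contributes to both of the first two sums. *)
Definition kirchhoff (G : metric_graph) (u : gfun G) : Prop :=
  exists (d0 : edge G -> R[i]) (d1 : bounded_edge G -> R[i]),
    [/\ forall e, right_derivative (u e) 0 (d0 e),
        forall b, left_derivative (u (inl b)) (elen b) (d1 b) &
        forall v : vertex G, core_vertex v ->
          \sum_(b : bounded_edge G | esrc b == v) d0 (inl b)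
          + \sum_(b : bounded_edge G | etgt b == v) (- d1 b)
          + \sum_(h : half_line G | hsrc h == v) d0 (inr h) = 0].

Definition bound_state (G : metric_graph) (p lambda mu : R) (u : gfun G) :
    Prop :=
  [/\ gH1_mass mu u, nls p lambda u & kirchhoff u].

Definition supported_on_core (G : metric_graph) (u : gfun G) : Prop :=
  forall (h : half_line G) (x : R), edge_dom (inr h) x -> u (inr h) x = 0.

End MetricGraph.

Arguments metric_graph : clear implicits.

(* Main.v *)
Require Import Defs.
From mathcomp Require Import all_boot all_order all_algebra.
From mathcomp Require Import complex ring lra.
From mathcomp Require Import all_classical all_reals all_analysis.
From mathcomp Require Import measurable_realfun.

Set Implicit Arguments.
Unset Strict Implicit.
Unset Printing Implicit Defensive.

Import Order.TTheory GRing.Theory Num.Theory.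
Import numFieldNormedType.Exports.

Local Open Scope classical_set_scope.
Local Open Scope ring_scope.

(** Why the theorem holds.  Suppose that, for some [tau > 0], all edges of the
    cycle have lengths in [tau * nat]; commensurability provides such a [tau]
    ([common_unit]).  Suppose also that the scalar equation
    [U'' = lambda U - |U|^(p-2) U] has a nontrivial real [tau]-periodic
    solution on the line with [U 0 = 0].  Then run [U] along the cycle and put
    zero on every other edge.  [U] vanishes at multiples of [tau], hence at
    every vertex, so the function is continuous and zero on the half-lines; and
    [U'] takes the same value at both ends of every edge of the cycle, so that
    at a vertex each unit of slope that enters along the cycle leaves along it,
    which is the Kirchhoff condition ([cycle_flux], [real_bound_state]).

    The real work is [periodic_solution]: every [tau] is a period of such a
    [U], whatever [lambda].  The conserved energy gives, for amplitude [a],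
    [U'^2 = a^2 (k (1 - |s|^p) - lambda (1 - s^2))] with [U = a s] and
    [k = (2/p) a^(p-2)].  Both terms are divisible by [1 - s^2]: if [g] is the
    slope function [g v = (1 - v^(p/2)) / (1 - v)], which is continuous with
    values in [[1, p/2]] on the unit interval ([powR_slope]), then with
    [s = sin theta] the energy identity becomes the regular first-order equation
    [theta' = omega theta], [omega = sqrt (k g(sin^2 theta) - lambda)].  This
    substitution removes the turning points, and it is solved by a quadrature
    and an inversion: [t(theta)] is a primitive of [1 / omega]
    ([continuous_antiderivative]), and [theta(t)] is its inverse
    ([inverse_of_increasing]).  Conversely [a sin(theta(t))] solves the
    second-order equation ([is_derive_phase_velocity]).

    The solution has period [t(2 pi)], which depends continuously on [k] and
    tends to [0] as [k] goes to infinity.  Nothing is known about its supremum,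
    so [tau] itself need not be attained, but [tau / n] is for [n] large, by the
    intermediate value theorem ([exists_period_divisor]), and a function of
    period [tau / n] has period [tau]. *)

(** * Calculus on the real line *)

Section RealLine.
Context {R : realType}.
Implicit Types (f g : R -> R) (x y : R).

Lemma is_derive_continuous f x (d : R) :
  is_derive x (1 : R) f d -> {for x, continuous f}.
Proof.
by case=> df _; exact/differentiable_continuous/derivable1_diffP.
Qed.

Lemma cvg0_norm_powR (r : R) : 0 < r -> `|z| `^ r @[z --> (0 : R)] --> (0 : R).
Proof.
move=> r0; apply/cvgrPdist_lt => e e0.
have d0 : 0 < e `^ r^-1 by rewrite powR_gt0.
near=> z; rewrite sub0r normrN ger0_norm ?powR_ge0//.
have -> : e = (e `^ r^-1) `^ r.
  by rewrite -powRrM mulVf ?gt_eqF// powRr1// ltW.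
apply: gt0_ltr_powR; rewrite ?nnegrE ?powR_ge0//.
Unshelve. all: by end_near. Qed.

(** At the origin [|s|^q = (|s|^(q-2) s) s], and the factor in parentheses is
    continuous there since its absolute value is [|s|^(q-1)]; this also covers
    [1 < q < 2], where [|s|^(q-2)] alone blows up. *)
Lemma is_derive_norm_powR (q x : R) : 1 < q ->
  is_derive x (1 : R) (fun s : R => `|s| `^ q) (q * (`|x| `^ (q - 2) * x)).
Proof.
move=> q1.
have powB (y : R) : 0 < y -> y `^ (q - 1) = y `^ (q - 2) * y.
  move=> y0; rewrite -{3}[y]powRr1 ?ltW// -powRD; last by rewrite (gt_eqF y0) implybT.
  by congr (_ `^ _); ring.
have [x0|x0|->] := ltgtP x 0.
- have d : is_derive x (1 : R) ((@powR R ^~ q) \o -%R) (q * (- x) `^ (q - 1) * (- 1)).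
    apply: is_derive1_comp; first by apply: is_derive1_powR; rewrite oppr_gt0.
  have -> : q * (`|x| `^ (q - 2) * x) = q * (- x) `^ (q - 1) * (- 1).
    by rewrite ltr0_norm// powB ?oppr_gt0//; ring.
  apply: near_eq_is_derive d.
  near=> y; rewrite /= ltr0_norm//; near: y; exact: lt_nbhsl.
- have d : is_derive x (1 : R) (@powR R ^~ q) (q * x `^ (q - 1)).
    exact: is_derive1_powR.
  have -> : q * (`|x| `^ (q - 2) * x) = q * x `^ (q - 1).
    by rewrite gtr0_norm// powB//; ring.
  apply: near_eq_is_derive d.
  near=> y; rewrite /= gtr0_norm//; near: y; exact: lt_nbhsr.
- rewrite normr0 !mulr0; apply/is_derive1_caratheodory.
  exists (fun z => `|z| `^ (q - 2) * z); split; last by rewrite mulr0.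
  + move=> z; rewrite normr0 powR0 ?subr0; last by lra.
    have [->|z0] := eqVneq z 0; first by rewrite normr0 mulr0 powR0//; lra.
    rewrite -mulrA -expr2 -real_normK ?num_real// -powR_mulrn//.
    rewrite -powRD; last by rewrite normr_eq0 z0 implybT.
    by congr (_ `^ _); ring.
  + rewrite /prop_for /continuous_at mulr0; apply: norm_cvg0.
    have q10 : 0 < q - 1 by lra.
    rewrite [X in X @ _ --> _](_ : _ = fun z : R => `|z| `^ (q - 1)).
      exact: cvg0_norm_powR.
    apply/funext => z; rewrite normrM ger0_norm ?powR_ge0//.
    have [->|z0] := eqVneq z 0; first by rewrite normr0 mulr0 powR0//; lra.
    by rewrite powB// normr_gt0.
Unshelve. all: by end_near. Qed.

(** [g] is the difference quotient of [|v|^q] based at [1], extended there by the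
    derivative [q]; absolute values make it continuous on the whole line.  On the
    unit interval [v^q <= v] gives [1 <= g v], and the mean value theorem gives
    [g v <= q]. *)
Lemma powR_slope (q : R) : 1 < q -> exists g : R -> R,
  [/\ continuous g,
      forall v, 0 <= v -> g v * (1 - v) = 1 - v `^ q,
      forall v, 0 <= v <= 1 -> 1 <= g v <= q &
      g 1 = q].
Proof.
move=> q1.
have dpow z := is_derive_norm_powR z q1.
have /is_derive1_caratheodory[g [gE g1 gq]] := dpow 1.
have {}gE z : `|z| `^ q - 1 = g z * (z - 1) by rewrite -gE normr1 powR1.
have {}gq : g 1 = q by rewrite gq normr1 powR1 !mulr1.
have gpow v : 0 <= v -> g v * (1 - v) = 1 - v `^ q.
  by move=> v0; have := gE v; rewrite ger0_norm// => e; lra.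
exists g; split => //.
- move=> z; have [->//|z1] := eqVneq z 1.
  have cz : {for z, continuous (fun y : R => (`|y| `^ q - 1) / (y - 1))}.
    apply: cvgM.
      apply: cvgB; last exact: cvg_cst.
      exact: is_derive_continuous (dpow z).
    apply: cvgV; first by rewrite subr_eq0.
    by apply: cvgB; [exact: cvg_id|exact: cvg_cst].
  have zN1 : \forall y \near z, y != 1.
    by have := open_nbhs_nbhs (conj (@open_neq R 1) z1).
  have gz y : y != 1 -> (`|y| `^ q - 1) / (y - 1) = g y.
    by move=> y1; rewrite gE mulfK// subr_eq0.
  rewrite /continuous_at -gz//.
  apply: cvg_trans cz; apply: near_eq_cvg; near=> y; rewrite gz//.
  by near: y.
- move=> v /andP[v0]; rewrite le_eqVlt => /predU1P[->|v1].
    by rewrite gq lexx ltW.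
  have v10 : 0 < 1 - v by lra.
  have [c cv] : exists2 c, c \in `]v, 1[ &
      `|1| `^ q - `|v| `^ q = (q * (`|c| `^ (q - 2) * c)) * (1 - v).
    apply: (MVT v1 (fun z _ => dpow z)).
    by apply: continuous_subspaceT => c; exact: is_derive_continuous (dpow c).
  have [vc c1] : v < c /\ c < 1 by move: cv; rewrite in_itv/= => /andP[].
  have c0 : 0 < c by lra.
  rewrite normr1 powR1 ger0_norm// -gpow// => /(mulIf (lt0r_neq0 v10)) gv.
  apply/andP; split.
    rewrite -(ler_pM2r v10) mul1r gpow// lerD2l lerN2.
    have [->|v0'] := eqVneq v 0; first by rewrite powR0//; lra.
    by apply: ge1r_powR; rewrite ?ltW// andbT lt_neqAle eq_sym v0'.
  rewrite gv ger_pMr; last by lra.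
  rewrite gtr0_norm// -{2}[c](powRr1 (ltW c0)) -powRD; last by rewrite (gt_eqF c0) implybT.
  rewrite -[leRHS](powRr0 c); apply: ger_powR; first by rewrite c0 ltW.
  by lra.
Unshelve. all: by end_near. Qed.

(** Integration from a base point [a] is differentiable only to the right of [a],
    so the base point [A x] is made to move with [x]; subtracting the integral
    up to [0] removes the dependence on it, and near a given point it can be
    replaced by a fixed one. *)
Lemma continuous_antiderivative f : continuous f ->
  exists F : R -> R, F 0 = 0 /\ forall x, is_derive x (1 : R) F (f x).
Proof.
move=> cf.
pose J (a x : R) := \int[@lebesgue_measure R]_(t in `[a, x]) f t.
have intf a b : (@lebesgue_measure R).-integrable `[a, b] (EFin \o f).
  apply: continuous_compact_integrable; first exact: segment_compact.
  exact: continuous_subspaceT.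
(* The [+ 1] leaves room to vary [x] while keeping the base point to its left. *)
pose A x : R := - (`|x| + 1).
pose F x := J (A x) x - J (A x) 0.
have FE a x : a <= A x -> F x = J a x - J a 0.
  rewrite /F /A => ax.
  have split_at y : - (`|x| + 1) <= y ->
     J a y = \int[@lebesgue_measure R]_(t in `[a, - (`|x| + 1)]) f t + J (- (`|x| + 1)) y.
    move=> y0.
    have := @Rintegral_itvB _ f (BLeft a) (BRight y) (- (`|x| + 1)) (intf a y).
    rewrite !bnd_simp => /(_ ax y0) /eqP; rewrite subr_eq => /eqP.
    rewrite /J => ->; rewrite addrC; congr (_ + _).
    apply: Rintegral_itv_obnd_cbnd.
    by apply: integrableS (intf (- (`|x| + 1)) y) => //; exact: subset_itv_oc_cc.
  have := ler_norm (- x); rewrite normrN => h.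
  by rewrite !split_at; [rewrite /J; ring|have := normr_ge0 x; lra|lra].
exists F; split; first by rewrite /F subrr.
move=> x.
pose a : R := - (`|x| + 2).
have ax : a < x by rewrite /a; have := ler_norm (- x); rewrite normrN; lra.
have [dJ J'] : derivable (J a) x 1 /\ derive1 (J a) x = f x.
  by apply: (@continuous_FTC1_closed _ f a x (x + 1)) => //; [lra|exact: cf].
have dF : is_derive x (1 : R) (fun y => J a y - J a 0) (f x).
  rewrite -[f x]subr0; apply: is_deriveB.
  by apply: (DeriveDef dJ); rewrite -derive1E; exact: J'.
apply: near_eq_is_derive dF; near=> y; rewrite (FE a)// /A /a.
suff : `|y| <= `|x| + 1 by lra.
near: y; exists 1 => //= y /=; rewrite distrC => xy.
have := ler_normD (y - x) x; rewrite subrK; lra.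
Unshelve. all: by end_near. Qed.

(** The uniform lower bound on the slope makes [F] onto the whole line, so that
    the inverse, which is a solution of [G' = 1 / f(G)], is global. *)
Lemma inverse_of_increasing (F f : R -> R) (c : R) : 0 < c ->
  (forall x, is_derive x (1 : R) F (f x)) -> (forall x, c <= f x) ->
  exists G : R -> R, [/\ cancel F G, cancel G F &
    forall y, is_derive y (1 : R) G (f (G y))^-1].
Proof.
move=> c0 dF fc.
have cF : continuous F by move=> x; exact: is_derive_continuous (dF x).
have Fincr x y : x <= y -> c * (y - x) <= F y - F x.
  rewrite le_eqVlt => /predU1P[->|xy]; first by rewrite !subrr mulr0.
  have [|z zxy ->] := MVT xy (fun z _ => dF z).
    exact: continuous_subspaceT.
  by rewrite ler_pM2r ?subr_gt0.
have Finj : injective F.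
  move=> x y Fxy; apply/eqP; rewrite eq_le; apply/andP; split; rewrite leNgt; apply/negP => h.
    have := Fincr _ _ (ltW h); rewrite Fxy subrr pmulr_rle0//; lra.
  have := Fincr _ _ (ltW h); rewrite Fxy subrr pmulr_rle0//; lra.
have Fsurj y : {x | F x = y}.
  apply: cid.
  pose M := `|y - F 0| / c + 1.
  have yM : `|y - F 0| = c * (M - 1) by rewrite /M addrK mulrC divfK// gt_eqF.
  have M0 : 0 <= M by rewrite addr_ge0// divr_ge0// ltW.
  have [| | |x _ <-] := @IVT _ F (- M) M y _ _ _; last by exists x.
  - lra.
  - exact: continuous_subspaceT.
  - have F1 := Fincr 0 M M0.
    have F2 := Fincr (- M) 0 ltac:(lra).
    have := ler_norm (y - F 0); have := ler_norm (- (y - F 0)).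
    rewrite normrN yM => h1 h2.
    rewrite ge_min le_max; apply/andP; split; apply/orP; [left|right]; nra.
pose G y := sval (Fsurj y).
have FG : cancel G F by move=> y; rewrite /G; case: (Fsurj y).
have GF : cancel F G by move=> x; apply: Finj; rewrite FG.
exists G; split => // y.
rewrite -{1}(FG y); apply: is_derive_inverse.
- by near=> x.
- by near=> x; exact: cF.
- by rewrite gt_eqF// (lt_le_trans c0).
Unshelve. all: by end_near. Qed.

Lemma is_derive_mull (c : R) (f : R -> R) x (d : R) :
  is_derive x (1 : R) f d -> is_derive x (1 : R) (fun y => c * f y) (c * d).
Proof. by move=> df; have := is_deriveZ c df. Qed.

(** This is the chain rule for a square root without any case analysis on the
    sign of [h x]: divide [h z ^+ 2 - h x ^+ 2] by [h z + h x]. *)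
Lemma is_derive_of_sqr (h : R -> R) x (d : R) :
  {for x, continuous h} -> h x != 0 ->
  is_derive x (1 : R) (fun y => h y ^+ 2) (2 * h x * d) -> is_derive x (1 : R) h d.
Proof.
move=> ch hx0 /is_derive1_caratheodory[G [GE cG Gx]].
apply/is_derive1_caratheodory.
exists (fun z => if z == x then d else (h z - h x) / (z - x)).
split; last by rewrite eqxx.
- move=> z; case: eqP => [->|/eqP zx]; first by rewrite !subrr mulr0.
  by rewrite divfK// subr_eq0.
- have hx2 : h x + h x != 0 by rewrite -mulr2n mulrn_eq0.
  have cq : {for x, continuous (fun z => G z / (h z + h x))}.
    by apply: cvgM => //; apply: cvgV => //; apply: cvgD => //; exact: cvg_cst.
  have qx : G x / (h x + h x) = d by rewrite Gx; apply: (mulIf hx2); rewrite divfK//; ring.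
  rewrite /prop_for /continuous_at eqxx -[X in _ --> X]qx.
  apply: cvg_trans cq; apply: near_eq_cvg; near=> z.
  have hz : h z + h x != 0.
    by near: z; apply: (cvgr_neq0 (h x + h x)) => //; apply: cvgD => //; exact: cvg_cst.
  case: eqP => [->//|/eqP zx].
  have zx0 : z - x != 0 by rewrite subr_eq0.
  apply: (mulIf zx0); rewrite divfK// mulrAC -GE.
  by field.
Unshelve. all: by end_near. Qed.

End RealLine.

(** * The period of the phase as a function of the amplitude *)

Section TimeMap.
Context {R : realType}.
Implicit Types (x y s : R).

Lemma sqrt_inv_lipschitz x y : 1 <= x -> 1 <= y ->
  `|(Num.sqrt x)^-1 - (Num.sqrt y)^-1| <= `|x - y|.
Proof.
move=> x1 y1.
have sqrt_ge1 (z : R) : 1 <= z -> 1 <= Num.sqrt z.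
  by move=> z1; rewrite -[leLHS]sqrtr1 ler_wsqrtr.
have a1 := sqrt_ge1 _ x1; have b1 := sqrt_ge1 _ y1.
rewrite -[X in _ <= `|X - _|]sqr_sqrtr; last by lra.
rewrite -[X in _ <= `|_ - X|]sqr_sqrtr; last by lra.
move: (Num.sqrt x) (Num.sqrt y) a1 b1 => a b a1 b1 {sqrt_ge1 x1 y1}.
have -> : a^-1 - b^-1 = (b - a) * (a * b)^-1 by field; apply/andP; split; lra.
rewrite normrM distrC subr_sqr normrM ler_wpM2l//.
have ab1 : 1 <= a * b by nra.
rewrite (@le_trans _ _ 1)//.
  by rewrite ger0_norm ?invr_ge0 ?invf_le1; lra.
by rewrite ger0_norm; lra.
Qed.

(** [t] is the time needed to reach a given phase, and [T] its increment over one
    period [P] of [g].  By the mean value theorem [T] is Lipschitz in [k] and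
    bounded by [P / sqrt (k - lambda)], so that it takes every value between
    [0] and its value at the smallest admissible [k]; [n] is chosen to bring
    [tau / n] into that range. *)
Lemma exists_period_divisor (lambda q P tau : R) (g : R -> R) :
    0 < P -> 0 < tau -> continuous g -> (forall x, 1 <= g x <= q) ->
    (forall x, g (x + P) = g x) ->
  exists (k : R) (n : nat) (t : R -> R),
    [/\ `|lambda| + 1 <= k, (0 < n)%N, t 0 = 0,
      (forall x, is_derive x (1 : R) t (Num.sqrt (k * g x - lambda))^-1) &
      forall x, t (x + P) = t x + tau / n%:R].
Proof.
move=> P0 tau0 cg gq gP.
(* [k = k0 + |s|] keeps [k g - lambda >= 1] for every real parameter [s]. *)
pose k0 := `|lambda| + 1.
pose X s x := (k0 + `|s|) * g x - lambda.
pose h s x := (Num.sqrt (X s x))^-1.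
have lamle := ler_norm lambda.
have Xge s x : 1 + `|s| <= X s x.
  have /andP[g1 _] := gq x; have s0 := normr_ge0 s.
  by rewrite /X /k0; have := normr_ge0 lambda; nra.
have X1 s x : 1 <= X s x by have := Xge s x; have := normr_ge0 s; lra.
have ch s : continuous (h s).
  move=> x; apply: cvgV; first by rewrite gt_eqF// sqrtr_gt0; have := X1 s x; lra.
  apply: (@continuous_comp _ _ _ (X s) Num.sqrt); last exact: sqrt_continuous.
  by apply: cvgB; [apply: cvgM; [exact: cvg_cst|exact: cg]|exact: cvg_cst].
have /choice[t tE] : forall s, exists F : R -> R,
    F 0 = 0 /\ forall x, is_derive x (1 : R) F (h s x).
  by move=> s; exact: continuous_antiderivative.
have t0 s : t s 0 = 0 by case: (tE s).
have dt s x : is_derive x (1 : R) (t s) (h s x) by case: (tE s).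
have ct s : continuous (t s).
  by move=> x; exact: is_derive_continuous (dt s x).
have tP s x : t s (x + P) = t s x + t s P.
  have dsh y : is_derive y (1 : R) (fun z => t s (z + P) - t s z) 0.
    rewrite (_ : 0 = h s (y + P) * 1 - h s y); last first.
      by rewrite /h /X gP mulr1 subrr.
    have d1 : is_derive y (1 : R) (fun z : R => z + P) 1.
      by rewrite -[X in is_derive _ _ _ X]addr0; apply: is_deriveD.
    have d2 : is_derive y (1 : R) (t s \o (fun z : R => z + P)) (h s (y + P) * 1).
      exact: is_derive1_comp.
    exact: (@is_deriveB _ _ _ (t s \o (fun z : R => z + P)) (t s)).
  have := is_derive_0_is_cst x 0 dsh.
  by rewrite add0r t0 subr0 => <-; ring.
pose T s := t s P.
have Tmvt s s' : exists c, T s - T s' = (h s c - h s' c) * P.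
  have dd x : is_derive x (1 : R) (fun y => t s y - t s' y) (h s x - h s' x).
    exact: is_deriveB.
  have [|c _] := MVT P0 (fun x _ => dd x).
    by apply: continuous_subspaceT => x; exact: is_derive_continuous (dd x).
  by rewrite !t0 subrr !subr0 => e; exists c.
have Tmvt0 s : exists c, T s = h s c * P.
  have [|c _] := MVT P0 (fun x _ => dt s x); first exact: continuous_subspaceT.
  by rewrite t0 !subr0 => e; exists c.
have h0 s x : 0 < h s x.
  by rewrite invr_gt0 sqrtr_gt0; have := X1 s x; lra.
have T0 s : 0 < T s by have [c ->] := Tmvt0 s; exact: mulr_gt0.
have q0 : 0 < q by have := gq 0; lra.
have Tlip s s' : `|T s - T s'| <= (q * P) * `|s - s'|.
  have [c ->] := Tmvt s s'.
  rewrite normrM (gtr0_norm P0) mulrAC ler_wpM2r ?(ltW P0)//.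
  apply: (le_trans (sqrt_inv_lipschitz (X1 s c) (X1 s' c))).
  have -> : X s c - X s' c = g c * (`|s| - `|s'|) by rewrite /X; ring.
  have /andP[g1 gc] := gq c.
  rewrite normrM ger0_norm; last by lra.
  by apply: ler_pM => //; [lra|exact: ler_dist_dist].
have cT : continuous T.
  move=> s; apply/cvgrPdist_lt => e e0.
  have d0 : 0 < e / (q * P) by rewrite divr_gt0// mulr_gt0.
  exists (e / (q * P)) => // s' /= ss'.
  apply: le_lt_trans (Tlip s s') _.
  by rewrite mulrC -ltr_pdivlMr// mulr_gt0.
pose n := (Num.truncn (tau / T 0)).+1.
have n0 : 0 < n%:R :> R by rewrite ltr0n.
have nT : tau / n%:R <= T 0.
  rewrite ler_pdivrMr// mulrC -ler_pdivrMr//.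
  by apply/ltW; exact: truncnS_gt.
(* At [s1] the frequency is at least [P n / tau], whence [T s1 <= tau / n]. *)
pose s1 := (P * n%:R / tau) ^+ 2.
have s10 : 0 <= s1 by exact: sqr_ge0.
have Ts1 : T s1 <= tau / n%:R.
  have [c ->] := Tmvt0 s1.
  have a0 : 0 < P * n%:R / tau by rewrite divr_gt0// mulr_gt0.
  have : P * n%:R / tau <= Num.sqrt (X s1 c).
    rewrite -[leLHS](gtr0_norm a0) -sqrtr_sqr ler_wsqrtr//.
    by have := Xge s1 c; rewrite (ger0_norm s10) /s1; lra.
  rewrite /h => le1.
  have -> : tau / n%:R = (P * n%:R / tau)^-1 * P.
    by field; rewrite !gt_eqF.
  rewrite ler_pM2r// lef_pV2// posrE; first exact: lt_le_trans le1.
have [| | |s _ Ts] := @IVT _ T 0 s1 (tau / n%:R).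
- exact: s10.
- exact: continuous_subspaceT.
- by rewrite ge_min le_max Ts1 nT orbT.
exists (k0 + `|s|), n, (t s); split => //.
- by rewrite lerDl.
- by move=> x; rewrite tP -/(T s) Ts.
Qed.

End TimeMap.

(** * Periodic solutions of the scalar equation *)

Section Oscillator.
Context {R : realType}.
Implicit Types (x y s : R).

Lemma sin_sqr_itv01 x : 0 <= sin x ^+ 2 <= 1.
Proof.
by rewrite sqr_ge0/=; have := cos2Dsin2 x; have := sqr_ge0 (cos x); lra.
Qed.

Lemma continuous_comp_sin_sqr (g : R -> R) :
  continuous g -> continuous (fun x => g (sin x ^+ 2)).
Proof.
move=> cg x.
apply: (@continuous_comp _ _ _ (fun y => sin y ^+ 2) g); last exact: cg.
by apply: (@continuous_comp _ _ _ sin (fun z : R => z ^+ 2));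
  [exact: continuous_sin|exact: exprn_continuous].
Qed.

(** [cos * omega] is [U' / a] as a function of the phase.  Its square is the
    differentiable function [k (1 - |sin|^p) - lambda cos^2], which settles the
    points where [cos] is nonzero.  At a turning point, where [omega] is not
    known to be differentiable, the factor [cos] vanishes, so continuity of
    [omega] suffices, and [g 1 = p / 2] makes the two formulas agree. *)
Lemma is_derive_phase_velocity (p k lambda : R) (g : R -> R) x :
    2 < p -> continuous g -> `|lambda| + 1 <= k ->
    (forall v, 0 <= v -> g v * (1 - v) = 1 - v `^ (p / 2)) ->
    (forall v, 0 <= v <= 1 -> 1 <= g v) -> g 1 = p / 2 ->
  let omega y := Num.sqrt (k * g (sin y ^+ 2) - lambda) in
  is_derive x (1 : R) (fun y => cos y * omega y)
    ((lambda * sin x - k * (p / 2) * (`|sin x| `^ (p - 2) * sin x)) / omega x).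
Proof.
move=> p2 cg kl gE g1 gp omega.
have sin01 := sin_sqr_itv01.
have arg_ge1 y : 1 <= k * g (sin y ^+ 2) - lambda.
  have := g1 _ (sin01 y); have := ler_norm lambda; have := normr_ge0 lambda; nra.
have omega2 y : omega y ^+ 2 = k * g (sin y ^+ 2) - lambda.
  by rewrite sqr_sqrtr//; have := arg_ge1 y; lra.
have omega0 y : 0 < omega y by rewrite sqrtr_gt0; have := arg_ge1 y; lra.
have comega : continuous omega.
  move=> y; apply: (@continuous_comp _ _ _ (fun y => k * g (sin y ^+ 2) - lambda) Num.sqrt);
    last exact: sqrt_continuous.
  apply: cvgB; last exact: cvg_cst.
  by apply: cvgM; [exact: cvg_cst|exact: continuous_comp_sin_sqr].
have [cx0|cx0] := eqVneq (cos x : R) 0.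
- have s2 : sin x ^+ 2 = 1 :> R by have := cos2Dsin2 x; rewrite cx0; lra.
  have ns : `|sin x| = 1 :> R.
    by apply/eqP; rewrite norm_sin_eq1 cx0.
  have /is_derive1_caratheodory[c [cE cc cx]] := is_derive_cos x.
  apply/is_derive1_caratheodory; exists (fun z => c z * omega z); split.
  + move=> z; rewrite cx0 mul0r subr0 mulrAC -cE cx0 subr0//.
  + by apply: cvgM => //; exact: comega.
  + rewrite cx ns powR1 mul1r; apply: (mulIf (lt0r_neq0 (omega0 x))).
    have o2 := omega2 x; rewrite s2 gp expr2 in o2.
    rewrite divfK ?lt0r_neq0// -(mulrA (- sin x)) o2; ring.
- apply: is_derive_of_sqr.
  + by apply: cvgM; [exact: continuous_cos|exact: comega].
  + by rewrite mulf_neq0// gt_eqF.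
  + have sqE y : (cos y * omega y) ^+ 2 =
        k * (1 - `|sin y| `^ p) - lambda * cos y ^+ 2.
      rewrite exprMn omega2.
      have -> : `|sin y : R| `^ p = (sin y ^+ 2) `^ (p / 2).
        rewrite -[sin y ^+ 2]real_normK ?num_real// -powR_mulrn// -powRrM.
        by congr (_ `^ _); field.
      rewrite -gE; last by rewrite sqr_ge0.
      by rewrite -cos2sin2; ring.
    have dpow : is_derive x (1 : R) ((fun s : R => `|s| `^ p) \o sin)
        (p * (`|sin x| `^ (p - 2) * sin x) * cos x).
      by apply: is_derive1_comp; apply: is_derive_norm_powR; lra.
    have dsq : is_derive x (1 : R) (fun y : R => cos y * cos y)
        (cos x *: (- sin x) + cos x *: (- sin x)).
      exact: (@is_deriveM _ _ cos cos).
    have dW : is_derive x (1 : R)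
        (fun y : R => k * (1 - `|sin y| `^ p) - lambda * (cos y * cos y))
        (k * (0 - p * (`|sin x| `^ (p - 2) * sin x) * cos x)
         - lambda * (cos x *: (- sin x) + cos x *: (- sin x))).
      apply: (@is_deriveB _ _ _ (fun y : R => k * (1 - `|sin y| `^ p))).

    rewrite (_ : (fun y => (cos y * omega y) ^+ 2) =
        (fun y : R => k * (1 - `|sin y| `^ p) - lambda * (cos y * cos y))); last first.
      by apply/funext => y; rewrite sqE -expr2.
    apply: is_derive_eq dW _.
    have om0 : omega x != 0 by rewrite gt_eqF.
    rewrite /= /GRing.scale/= mulr2n.
    by field.
Qed.

(** The nonlinearity is superlinear, so that the period of the solution of
    amplitude [a] tends to [0] as [a] grows: this is what makes every [tau] a
    (not necessarily minimal) period, for all signs of [lambda]. *)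
Lemma periodic_solution (p lambda tau : R) : 2 < p -> 0 < tau ->
  exists U V : R -> R,
    [/\ U 0 = 0 /\ V 0 != 0,
      forall x, U (x + tau) = U x, forall x, V (x + tau) = V x,
      forall x, is_derive x (1 : R) U (V x) &
      forall x, is_derive x (1 : R) V (lambda * U x - `|U x| `^ (p - 2) * U x)].
Proof.
move=> p2 tau0.
have p21 : 1 < p / 2 by lra.
have [g [cg gE g1q g1]] := powR_slope p21.
have sin01 := sin_sqr_itv01.
have cgs := continuous_comp_sin_sqr cg.
have pi2 : 0 < pi *+ 2 :> R by rewrite mulrn_wgt0// pi_gt0.
have [k [n [t [kl n0 t0 dt tP]]]] := exists_period_divisor lambda pi2 tau0 cgs
  (fun y => g1q _ (sin01 y)) (fun y => congr1 (fun s => g (s ^+ 2)) (sinD2pi y)).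
pose omega y := Num.sqrt (k * g (sin y ^+ 2) - lambda).
have dh (y : R) := is_derive_phase_velocity y p2 cg kl gE
  (fun v v01 => proj1 (andP (g1q v v01))) g1.
have lam0 := normr_ge0 lambda.
have k0 : 0 < k by lra.
have omega0 y : 0 < omega y.
  rewrite sqrtr_gt0; have /andP[g1y _] := g1q _ (sin01 y).
  by have := ler_norm lambda; nra.
pose M := k * (p / 2) + `|lambda| + 1.
have M0 : 0 < M by rewrite /M; nra.
have omegaM y : (Num.sqrt M)^-1 <= (omega y)^-1.
  have le_M : omega y <= Num.sqrt M.
    apply: ler_wsqrtr; have /andP[_ gy] := g1q _ (sin01 y).
    by have := ler_norm (- lambda); rewrite normrN /M; nra.
  by rewrite lef_pV2// posrE ?omega0// sqrtr_gt0.
have sM0 : 0 < (Num.sqrt M)^-1 by rewrite invr_gt0 sqrtr_gt0.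
have [theta [tK thetaK dtheta]] := inverse_of_increasing sM0 dt omegaM.
have thetaP x : theta (x + tau / n%:R) = theta x + pi *+ 2.
  by apply: (can_inj tK); rewrite thetaK tP thetaK.
(* The amplitude that matches the parameter [k = (2/p) a^(p-2)]. *)
have [a a0 ap] : exists2 a : R, 0 < a & a `^ (p - 2) = k * (p / 2).
  exists ((k * (p / 2)) `^ (p - 2)^-1); first by apply: powR_gt0; nra.
  by rewrite -powRrM mulVf ?powRr1; [|nra|lra].
have {}dtheta x : is_derive x (1 : R) theta (omega (theta x)).
  by rewrite -[omega _]invrK; exact: dtheta.
have theta0 : theta 0 = 0 by rewrite -t0 tK.
pose U x := a * sin (theta x).
pose V x := a * (cos (theta x) * omega (theta x)).
have tauE (f : R -> R) : periodic f (tau / n%:R) -> periodic f tau.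
  move=> fP x; rewrite -[in LHS](divfK (lt0r_neq0 _ : n%:R != 0) tau) ?ltr0n//.
  by rewrite mulr_natr periodicn.
exists U, V; split.
- rewrite /U /V theta0 sin0 cos0 mulr0 mul1r; split => //.
  by rewrite mulf_neq0 ?lt0r_neq0.
- by apply: tauE => x; rewrite /U thetaP sinD2pi.
- by apply: tauE => x; rewrite /V /omega thetaP sinD2pi cosD2pi.
- move=> x; rewrite /V /U.
  by apply: is_derive_mull; exact: is_derive1_comp.
- move=> x; rewrite /V.
  have d1 : is_derive x (1 : R) ((fun y => cos y * omega y) \o theta) _ :=
    is_derive1_comp (dh (theta x)) (dtheta x).
  apply: is_derive_eq (is_derive_mull a d1) _.
  rewrite divfK; last exact: lt0r_neq0 (omega0 (theta x)).
  by rewrite /U normrM (gtr0_norm a0) powRM ?normr_ge0 ?(ltW a0)// ap; ring.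
Qed.

End Oscillator.

(** * Classical functions on an interval *)

Section Interval.
Context {R : realType}.
Implicit Types (f g F : R -> R) (x y l : R).
Notation mu := (@lebesgue_measure R).

Lemma continuous_L2_segment f l : continuous f -> L2 [set` `[0, l]] f.
Proof.
move=> cf; split.
  apply: subspace_continuous_measurable_fun; first exact: measurable_itv.
  exact: continuous_subspaceT.
apply: (@continuous_compact_integrable _ (fun x => f x ^+ 2)).
  exact: segment_compact.
apply: continuous_subspaceT => x.
by apply: (@continuous_comp _ _ _ f (fun z : R => z ^+ 2)); [exact: cf|exact: exprn_continuous].
Qed.

Lemma is_derive_oo_LRcontinuous f g (a b : R) :
  (forall x, is_derive x (1 : R) f (g x)) -> derivable_oo_LRcontinuous f a b.
Proof.
move=> df; have cf x := is_derive_continuous (df x); split.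
- by move=> x _; case: (df x).
- exact/cvg_at_right_filter/cf.
- exact/cvg_at_left_filter/cf.
Qed.

(** The classical derivative is a weak one: a test function vanishes at both ends
    of the segment, which kills the boundary terms of the integration by
    parts. *)
Lemma C1_H1_segment f g l : 0 < l ->
  (forall x, is_derive x (1 : R) f (g x)) -> continuous g ->
  H1 [set` `[0, l]] f.
Proof.
move=> l0 df cg.
have cf : continuous f by move=> x; exact: is_derive_continuous (df x).
split; first exact: continuous_L2_segment.
exists g; first exact: continuous_L2_segment.
move=> phi [smooth [a [b [abI suppphi]]]].
have dphi x : is_derive x (1 : R) phi (derive1 phi x).
  by rewrite derive1E; apply: derivableP; exact: (smooth 0%N).
have cdphi : continuous (derive1 phi).
  move=> x; apply/differentiable_continuous/derivable1_diffP.
  exact: (smooth 1%N).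
have phi0 x : x \notin `]0, l[ -> phi x = 0.
  move=> xI; apply: suppphi; apply: contra xI.
  by rewrite !inE => /abI; rewrite interior_itv_bnd.
have g' : {in `]0, l[, derive1 f =1 g}.
  by move=> x _; rewrite derive1E; have [_ ->] := df x.
rewrite (Rintegration_by_parts l0 _ (is_derive_oo_LRcontinuous 0 l df) g' _ (is_derive_oo_LRcontinuous 0 l dphi)).
- by rewrite !phi0 ?mulr0 ?subr0 ?sub0r//; rewrite in_itv/= ltxx ?andbF.
- exact: continuous_subspaceT.
- exact: continuous_subspaceT.
- by [].
Qed.

Lemma H1_zero (D : set R) : measurable D -> H1 D (fun=> 0).
Proof.
move=> mD.
have L20 : L2 D (fun=> 0 : R).
  split; first exact: measurable_cst.
  rewrite (_ : (fun _ => _) = cst 0%E); first exact: integrable0.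
  by apply/funext => x; rewrite expr0n.
split => //; exists (fun=> 0) => // phi _.
have R0 (h : R -> R) : \int[mu]_(x in D) (0 * h x) = 0.
  rewrite (_ : (fun x => 0 * h x) = cst 0); last by apply/funext => x; rewrite mul0r.
  by rewrite /Rintegral /= integral0.
by rewrite !R0 oppr0.
Qed.

(** A primitive of [f ^+ 2] is nondecreasing; were it to have equal values at the
    ends, it would be constant near [x], against [f x != 0]. *)
Lemma integral_sqr_gt0 f l x : continuous f -> 0 < x < l -> f x != 0 ->
  (0 < \int[mu]_(t in [set` `[0%R, l]]) (f t ^+ 2)%:E)%E.
Proof.
move=> cf /andP[x0 xl] fx0.
have cf2 : continuous (fun t => f t ^+ 2).
  by move=> y; apply: (@continuous_comp _ _ _ f (fun z : R => z ^+ 2)); [exact: cf|exact: exprn_continuous].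
have [F [F0 dF]] := continuous_antiderivative cf2.
have l0 : 0 < l by lra.
rewrite (continuous_FTC2 l0 _ (is_derive_oo_LRcontinuous 0 l dF)); last 2 first.
- exact: continuous_subspaceT.
- by move=> y _; rewrite derive1E; have [_ ->] := dF y.
have cF : continuous F by move=> y; exact: is_derive_continuous (dF y).
have Fle y z : y < z -> F y <= F z.
  move=> yz; have [|c _ FE] := MVT yz (fun y _ => dF y).
    exact: continuous_subspaceT.
  by rewrite -subr_ge0 FE mulr_ge0 ?sqr_ge0// subr_ge0 ltW.
rewrite -EFinB lte_fin subr_gt0 lt_neqAle Fle// andbT.
apply/eqP => F0l.
have d0 : is_derive x (1 : R) F 0.
  apply: (@near_eq_is_derive _ _ _ (cst (F 0))).
  near=> y; apply/eqP; rewrite eq_le; apply/andP; split.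
    apply: Fle; near: y; exact: lt_nbhsr.
  rewrite F0l; apply: Fle; near: y; exact: lt_nbhsl.
have [_ e1] := d0; have [_ e2] := dF x.
by move: fx0; rewrite -sqrf_eq0 -e2 e1 eqxx.
Unshelve. all: by end_near. Qed.

Lemma is_derive_difference_quotient f x (d : R) :
  is_derive x (1 : R) f d -> h^-1 * (f (x + h) - f x) @[h --> 0^'] --> d.
Proof.
move=> [/cvg_ex[l fl] fd].
have <- : l = d by rewrite -fd; apply/esym/cvg_lim.
by apply: cvg_trans fl; apply: near_eq_cvg; near=> h;
  rewrite /= [_%:A]mulr1 [h + x]addrC.
Unshelve. all: by end_near. Qed.

End Interval.

(** * Commensurable lengths and cyclic sequences *)

Section Combinatorics.

(** If [N] is a common denominator of the ratios [x / l0], then [l0 / N] is a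
    common unit; the numerators are natural because the lengths are positive. *)
Lemma common_unit (R : realType) (l0 : R) (s : seq R) : 0 < l0 ->
  (forall x, x \in s -> 0 < x /\ rational (x / l0)) ->
  exists2 tau : R, 0 < tau & forall x, x \in s -> exists n : nat, x = n%:R * tau.
Proof.
move=> l00 sP.
suff [N N0 NP] : exists2 N : nat, (0 < N)%N &
    forall x, x \in s -> exists n : nat, x = n%:R * (l0 / N%:R).
  by exists (l0 / N%:R) => //; rewrite divr_gt0// ltr0n.
elim: s sP => [|y s IH] sP; first by exists 1%N.
have [x xs|N N0 NP] := IH; first by apply: sP; rewrite inE xs orbT.
have [y0 /rationalP[a [b ab]]] := sP y (mem_head _ _).
have yl0 : 0 < y / l0 by rewrite divr_gt0.
have b0 : (0 < b)%N.
  by case: b ab => // ab; move: yl0; rewrite ab invr0 mulr0 ltxx.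
have bR : b%:R != 0 :> R by rewrite pnatr_eq0 -lt0n.
have NR : N%:R != 0 :> R by rewrite pnatr_eq0 -lt0n.
have l0R : l0 != 0 by rewrite gt_eqF.
case: a ab => [a|a] ab; last first.
  by move: yl0; rewrite ab pmulr_lgt0 ?invr_gt0 ?ltr0n// ltr0z.
exists (N * b)%N; first by rewrite muln_gt0 N0.
move=> x; rewrite inE => /predU1P[->|xs].
  exists (a * N)%N; rewrite !natrM.
  rewrite -[LHS](divfK l0R) ab -pmulrn; field; exact/andP.
have [n ->] := NP _ xs; exists (n * b)%N; rewrite !natrM.
by field; exact/andP.
Qed.

Lemma uniq_map_inj (T T' : eqType) (f : T -> T') (s : seq T) (x y : T) :
  uniq (map f s) -> x \in s -> y \in s -> f x = f y -> x = y.
Proof.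
elim: s => //= z s IH /andP[zs us]; rewrite !inE.
move=> /predU1P[->|xs] /predU1P[->|ys]// fxy.
- by rewrite fxy map_f in zs.
- by rewrite -fxy map_f in zs.
- exact: IH.
Qed.

Lemma cycle_perm_ends (T V : eqType) (from to : T -> V) (c : seq T) :
  cycle (fun d d' => to d == from d') c -> perm_eq (map from c) (map to c).
Proof.
have path_ends x s : path (fun d d' => to d == from d') x s ->
    map to (belast x s) = map from s.
  by elim: s x => //= y s IH x /andP[/eqP-> /IH->].
case: c => // x s /path_ends; rewrite belast_rcons => ->.
by rewrite map_rcons perm_sym perm_rcons.
Qed.

End Combinatorics.

(** * From real edge profiles to a bound state *)

Section Gluing.
Context {R : realType}.
Notation mu := (@lebesgue_measure R).

Definition extend_by_zero (G : metric_graph R) (f : bounded_edge G -> R -> R)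
    (e : edge G) : R -> R :=
  if e is inl b then f b else fun=> 0.

Definition real_gfun (G : metric_graph R) (f : bounded_edge G -> R -> R) : gfun G :=
  fun e x => (extend_by_zero f e x)%:C%C.

(** Profiles that vanish at all vertices glue to a continuous function whatever
    the graph, and the half-lines add nothing to the Kirchhoff sums; what remains
    is a balance between outgoing slopes at initial ends and incoming slopes at
    final ends.  Asking for the equation on the whole line, beyond the edge,
    gives the one-sided derivatives at the ends for free. *)
Lemma real_bound_state (G : metric_graph R) (p lambda : R)
    (f g : bounded_edge G -> R -> R) :
    (forall b x, is_derive x (1 : R) (f b) (g b x)) ->
    (forall b x, is_derive x (1 : R) (g b)
       (lambda * f b x - `|f b x| `^ (p - 2) * f b x)) ->
    (forall b, f b 0 = 0 /\ f b (elen b) = 0) ->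
    (forall v : vertex G, \sum_(b : bounded_edge G | esrc b == v) g b 0
                        = \sum_(b : bounded_edge G | etgt b == v) g b (elen b)) ->
    (exists b x, 0 < x < elen b /\ f b x != 0) ->
  exists m : R, 0 < m /\
    exists u : gfun G, bound_state p lambda m u /\ supported_on_core u.
Proof.
move=> df dg f0 kir [b0 [x0 [x0I fx0]]].
pose F := extend_by_zero f; pose F' := extend_by_zero g.
have dF e x : is_derive x (1 : R) (F e) (F' e x).
  by case: e => [b|h]; [exact: df|exact: is_derive_cst].
have dF' e x : is_derive x (1 : R) (F' e)
    (lambda * F e x - kappa e * `|F e x| `^ (p - 2) * F e x).
  case: e => [b|h] /=; first by rewrite mul1r; exact: dg.
  by rewrite !mulr0 subrr; exact: is_derive_cst.
have F'E e : derive1 (F e) = F' e.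
  by apply/funext => x; rewrite derive1E; have [_ ->] := dF e x.
have cF e : continuous (F e) by move=> x; exact: is_derive_continuous (dF e x).
have cF' e : continuous (F' e) by move=> x; exact: is_derive_continuous (dF' e x).
pose u : gfun G := real_gfun f.
have im0 e : derive1 (im (u e)) = fun=> 0.
  by apply/funext => x; rewrite derive1E; exact: derive_cst.
have normu e x : Normc.normc (u e x) ^+ 2 = F e x ^+ 2.
  by rewrite /= expr0n addr0 sqr_sqrtr ?sqr_ge0.
pose I (e : edge G) := (\int[mu]_(x in edge_dom e) (Normc.normc (u e x) ^+ 2)%:E)%E.
have IE e : I e = (\int[mu]_(x in edge_dom e) (F e x ^+ 2)%:E)%E.
  by apply: eq_integral => x _; rewrite normu.
have H1F e : H1 (edge_dom e) (F e).
  case: e => [b|h] /=; last by apply: H1_zero; exact: measurable_itv.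
  exact: C1_H1_segment (elen_gt0 b) (df b) (cF' (inl b)).
have I_ge0 e : (0 <= I e)%E.
  by rewrite IE; apply: integral_ge0 => x _; rewrite lee_fin sqr_ge0.
have I_fin e : I e \is a fin_num.
  rewrite IE; apply: integrable_fin_num; last by case: (H1F e) => -[].
  by case: e => *; exact: measurable_itv.
have I_gt0 : (0 < I (inl b0))%E.
  by rewrite IE /=; exact: integral_sqr_gt0 (cF (inl b0)) x0I fx0.
have mass_fin : mass u \is a fin_num.
  by rewrite /mass; apply/sum_fin_numP => e _ _; exact: I_fin.
exists (fine (mass u)); split.
  rewrite fine_gt0//; apply/andP; split; last by rewrite ltey_eq mass_fin.
  rewrite /mass (bigD1 (inl b0))//=; apply: (lt_le_trans I_gt0).
  by rewrite leeDl//; apply: sume_ge0 => e _; exact: I_ge0.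
exists u; split; last by [].
split.
- split; last by rewrite fineK.
  split.
    split.
      move=> e; split; first by apply: continuous_subspaceT => x; exact: cF.
      by apply: continuous_subspaceT => x; exact: cst_continuous.
    exists (fun=> 0); split => // b; rewrite /u /real_gfun /=.
    by have [-> ->] := f0 b.
  move=> e; split; first exact: H1F.
  by apply: H1_zero; case: e => *; exact: measurable_itv.
- move=> e x _; split.
    split.
    + by case: (dF e x).
    + exact: derivable_cst.
    + by rewrite -[re (u e)]/(F e) F'E; case: (dF' e x).
    + by rewrite im0; exact: derivable_cst.
  have -> : second_derivative (u e) x =
      (lambda * F e x - kappa e * `|F e x| `^ (p - 2) * F e x)%:C%C.
    rewrite /second_derivative /= im0 -[re (u e)]/(F e) F'E !derive1E derive_cst.
    by have [_ ->] := dF' e x.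
  have -> : Normc.normc (u e x) = `|F e x| by rewrite /= expr0n addr0 sqrtr_sqr.
  by rewrite -!rmorphM -rmorphD/= subrK.
- exists (fun e => (F' e 0)%:C%C), (fun b => (F' (inl b) (elen b))%:C%C); split.
  + move=> e; split; first exact/cvg_dnbhs_at_right/is_derive_difference_quotient/dF.
    exact/cvg_dnbhs_at_right/is_derive_difference_quotient/is_derive_cst.
  + move=> b; split; first exact/cvg_dnbhs_at_left/is_derive_difference_quotient/(dF (inl b)).
    exact/cvg_dnbhs_at_left/is_derive_difference_quotient/is_derive_cst.
  + move=> v _.
    rewrite [X in _ + X]big1 ?addr0// sumrN -!rmorph_sum -rmorphB/=.
    by rewrite kir subrr.
Qed.

End Gluing.

(** * The Kirchhoff condition along a cycle *)

Section Cycle.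
Context {R : realType}.

(** With coefficient [1] on the edges of the cycle traversed forwards, [-1] on
    those traversed backwards and [0] elsewhere, the two sides differ by the
    number of darts of the cycle leaving [v] minus the number of those reaching
    [v], and the latter numbers agree because the end vertices of a cyclic
    sequence are a rotation of its initial vertices. *)
Lemma cycle_flux (G : metric_graph R) (c : seq (dart G)) (v : vertex G) :
    is_cycle c ->
  \sum_(b : bounded_edge G | esrc b == v)
     (((b, true) \in c)%:R - ((b, false) \in c)%:R : R) =
  \sum_(b : bounded_edge G | etgt b == v)
     (((b, true) \in c)%:R - ((b, false) \in c)%:R).
Proof.
case=> _ cyc uc _.
have {uc} uc : uniq c by exact: map_uniq uc.
have dart_sum (F : dart G -> R) : \sum_(d <- c) F d =
    \sum_(b : bounded_edge G)
      (((b, true) \in c)%:R * F (b, true) + ((b, false) \in c)%:R * F (b, false)).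
  transitivity (\sum_(b : bounded_edge G) \sum_(e : bool)
      ((b, e) \in c)%:R * F (b, e)); last first.
    by apply: eq_bigr => b _; rewrite big_bool.
  rewrite pair_bigA /= big_uniq// big_mkcond/=; apply: eq_bigr => -[b e] _ /=.
  by case: ifP; rewrite ?mul1r ?mul0r.
have ends : \sum_(d <- c) (dart_from d == v)%:R = \sum_(d <- c) (dart_to d == v)%:R :> R.
  rewrite -(big_map (@dart_from _ G) xpredT (fun w => (w == v)%:R)).
  rewrite -(big_map (@dart_to _ G) xpredT (fun w => (w == v)%:R)).
  exact/perm_big/cycle_perm_ends.
move: ends; rewrite !dart_sum /dart_from /dart_to /= => ends.
rewrite big_mkcond [RHS]big_mkcond/=.
apply/eqP; rewrite -subr_eq0 -sumrB; apply/eqP.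
rewrite -[RHS](subrr (\sum_(b : bounded_edge G)
  (((b, true) \in c)%:R * (esrc b == v)%:R + ((b, false) \in c)%:R * (etgt b == v)%:R : R))).
rewrite [in X in _ = _ - X]ends -sumrB; apply: eq_bigr => b _.
by case: (esrc b == v); case: (etgt b == v); rewrite /=; ring.
Qed.

End Cycle.

Theorem theorem4p2 (R : realType) (p lambda : R) (G : metric_graph R)
    (hp : 2 < p)
    (hG : noncompact G)
    (hK : nonempty_core G)
    (hC : exists c : seq (dart G), is_cycle c /\ commensurable c) :
  exists mu : R, 0 < mu /\
    exists u : gfun G,
      bound_state p lambda mu u /\ supported_on_core u.
Proof.
have [c [cyc comm]] := hC.
have [c0 _ uc _] := cyc.
have [d0 d0c] : exists d0, d0 \in c by case: c c0 {comm cyc uc} => // d s _; exists d; exact: mem_head.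
have len0 := elen_gt0 d0.1.
have [tau tau0 lenE] : exists2 tau : R, 0 < tau &
    forall x, x \in map (@elen _ G) (map fst c) -> exists n : nat, x = n%:R * tau.
  apply: (common_unit len0) => x /mapP[b bc ->]; split; first exact: elen_gt0.
  by apply: comm => //; exact: map_f.
have {}lenE d : d \in c -> exists n : nat, elen d.1 = tau *+ n.
  move=> dc; have [|n ->] := lenE (elen d.1); first by do 2!apply: map_f.
  by exists n; rewrite mulr_natl.
have [U [V [[U0 V0] UP VP dU dV]]] := periodic_solution lambda hp tau0.
have Ulen d x : d \in c -> U (x + elen d.1) = U x.
  by move=> /lenE[n ->]; exact: periodicn.
have Vlen d x : d \in c -> V (x + elen d.1) = V x.
  by move=> /lenE[n ->]; exact: periodicn.
have one_dir b : (b, true) \in c -> (b, false) \in c -> False.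
  by move=> bt bf; have := uniq_map_inj uc bt bf erefl.
(* A reversed edge carries [U (l - x)], so that the solution runs on in the
   direction of travel. *)
pose f b x := if (b, true) \in c then U x
              else if (b, false) \in c then U (elen b - x) else 0.
pose g b x := if (b, true) \in c then V x
              else if (b, false) \in c then - V (elen b - x) else 0.
have dflip (l x : R) : is_derive x (1 : R) (fun y => l - y) (-1).
  by rewrite -[X in is_derive _ _ _ X]sub0r; apply: is_deriveB.
have Ulen0 d : d \in c -> U (elen d.1) = 0.
  by move=> dc; rewrite -[elen _]add0r Ulen.
apply: (@real_bound_state _ G p lambda f g).
- move=> b x; rewrite /f /g; case: ifP => _; first exact: dU.
  case: ifP => _; last exact: is_derive_cst.
  have := @is_derive1_comp _ U (fun y => elen b - y) _ _ _ (dU (elen b - x)) (dflip (elen b) x).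
  by rewrite mulrN1.
- move=> b x; rewrite /f /g; case: ifP => _; first exact: dV.
  case: ifP => _; last by rewrite !mulr0 subrr; exact: is_derive_cst.
  have := is_deriveN (@is_derive1_comp _ V (fun y => elen b - y) _ _ _ (dV (elen b - x)) (dflip (elen b) x)).
  by rewrite mulrN1 opprK.
- move=> b; rewrite /f; case: ifP => [bc|_]; first by rewrite U0 (Ulen0 _ bc).
  by case: ifP => [bc|_]//; rewrite subr0 subrr U0 (Ulen0 _ bc).
- move=> v.
  have g0 b : g b 0 = V 0 * (((b, true) \in c)%:R - ((b, false) \in c)%:R).
    rewrite /g subr0; have [bt|bt] := boolP ((b, true) \in c).
      by rewrite (negbTE (introN idP (one_dir b bt))) subr0 mulr1.
    case: ifP => [bf|_]; last by rewrite subrr mulr0.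
    by rewrite -[elen b]add0r (Vlen _ _ bf) sub0r mulrN1.
  have gl b : g b (elen b) = V 0 * (((b, true) \in c)%:R - ((b, false) \in c)%:R).
    rewrite /g subrr; have [bt|bt] := boolP ((b, true) \in c).
      by rewrite -[elen b]add0r (Vlen _ _ bt) (negbTE (introN idP (one_dir b bt))) subr0 mulr1.
    by case: ifP => [bf|_]; [rewrite sub0r mulrN1|rewrite subrr mulr0].
  rewrite (eq_bigr _ (fun b _ => g0 b)) [RHS](eq_bigr _ (fun b _ => gl b)).
  by rewrite -!mulr_sumr cycle_flux.
(* [U] is nonzero just to the right of [0], where its slope is [V 0 != 0]. *)
- have [y y0l Uy] : exists2 y, 0 < y < elen d0.1 & U y != 0.
    have /is_derive1_caratheodory[W [WE cW W0]] := dU 0.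
    have WN0 : \forall z \near (0 : R)^'+, W z != 0.
      apply: (cvgr_neq0 (W 0)); last by rewrite W0.
      exact: cvg_at_right_filter.
    near (0 : R)^'+ => y.
    have y0 : 0 < y by [].
    exists y; first by rewrite y0/=; near: y; exact: nbhs_right_lt.
    have := WE y; rewrite U0 !subr0 => ->.
    apply: mulf_neq0; last by rewrite gt_eqF.
    by near: y.
  move: d0c y0l; case: (d0) => b [] bc yl; exists b.
    by exists y; rewrite /f bc yl.
  exists (elen b - y); split; first by move: yl => /=; lra.
  rewrite /f bc; case: ifP => [/one_dir/(_ bc)//|_].
  by rewrite opprB addrCA subrr addr0.
Unshelve. all: by end_near. Qed.
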